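(* Let $A=D[x,y;\sigma,\tau,a]$ be a generalized Weyl algebra. Suppose that $*$ is an involution of the ring $D$ such that $\sigma *\tau=*$, $\tau *\sigma=*$ (as compositions of maps $D\to D$), $a^*=a$ and $\sigma(a)^*=\sigma(a)$. Then the involution $*$ can be extended to an involution $*$ of $A$ by the rule $x^*=y$ and $y^*=x$.
   Context: Generalized Weyl algebra (GWA): let $D$ be a ring (associative, with 1), $\sigma,\tau$ ring endomorphisms of $D$ and $a\in D$ such that $\tau\sigma(a)=a$, $ad=\tau\sigma(d)a$ and $\sigma(a)d=\sigma\tau(d)\sigma(a)$ for all $d\in D$. Then $A=D[x,y;\sigma,\tau,a]$ is the ring generated by $D$, $x$ and $y$ subject to the defining relations $xd=\sigma(d)x$, $yd=\tau(d)y$ for all $d\in D$, $yx=a$, $xy=\sigma(a)$. Products of endomorphisms are compositions. An involution of a ring $R$ is an anti-isomorphism $*$ of $R$ (additive bijection with $(rs)^*=s^*r^*$) such that $r^{**}=r$ for all $r\in R$. *)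

(* Defs.v *)
From HB Require Import structures.
From mathcomp Require Import all_boot all_algebra generic_quotient.
From mathcomp Require Import boolp.
Set Implicit Arguments.
Unset Strict Implicit.
Unset Printing Implicit Defensive.
Import GRing.Theory.
Local Open Scope ring_scope.
Local Open Scope quotient_scope.

(* Rings are [pzRingType]s: associative and unital, possibly zero; ring
   endomorphisms [{rmorphism D -> D}] preserve 1. *)

Definition anti_isomorphism (R S : pzRingType) (f : R -> S) : Prop :=
  [/\ bijective f,
      forall r s : R, f (r + s) = f r + f s &
      forall r s : R, f (r * s) = f s * f r].

Definition involution (R : pzRingType) (f : R -> R) : Prop :=
  anti_isomorphism f /\ forall r : R, f (f r) = r.

Definition gwa_datum (D : pzRingType) (sigma tau : {rmorphism D -> D}) (a : D)
    : Prop :=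
  [/\ tau (sigma a) = a,
      forall d : D, a * d = tau (sigma d) * a &
      forall d : D, sigma a * d = sigma (tau d) * sigma a].

(* [gwa sigma tau a] is the ring D[x, y; sigma, tau, a] given by generators and
   relations: ring expressions in x, y and the elements of D, modulo the least
   congruence [gwa_eq] that satisfies the ring axioms, makes [GConst] a ring
   morphism and contains the defining relations. *)

Inductive gwa_expr (D : Type) : Type :=
| GConst of D
| GX
| GY
| GAdd of gwa_expr D & gwa_expr D
| GOpp of gwa_expr D
| GMul of gwa_expr D & gwa_expr D.
Arguments GX {D}.
Arguments GY {D}.

HB.instance Definition _ (D : Type) := gen_eqMixin (gwa_expr D).
HB.instance Definition _ (D : Type) := gen_choiceMixin (gwa_expr D).

Section Presentation.
Variables (D : pzRingType) (sigma tau : {rmorphism D -> D}) (a : D).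

Inductive gwa_eq : gwa_expr D -> gwa_expr D -> Prop :=
| gwa_refl u : gwa_eq u u
| gwa_sym u v : gwa_eq u v -> gwa_eq v u
| gwa_trans u v w : gwa_eq u v -> gwa_eq v w -> gwa_eq u w
| gwa_congD u u' v v' :
    gwa_eq u u' -> gwa_eq v v' -> gwa_eq (GAdd u v) (GAdd u' v')
| gwa_congN u u' : gwa_eq u u' -> gwa_eq (GOpp u) (GOpp u')
| gwa_congM u u' v v' :
    gwa_eq u u' -> gwa_eq v v' -> gwa_eq (GMul u v) (GMul u' v')
| gwa_addA u v w : gwa_eq (GAdd u (GAdd v w)) (GAdd (GAdd u v) w)
| gwa_addC u v : gwa_eq (GAdd u v) (GAdd v u)
| gwa_add0 u : gwa_eq (GAdd (GConst 0) u) u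
| gwa_addN u : gwa_eq (GAdd (GOpp u) u) (GConst 0)
| gwa_mulA u v w : gwa_eq (GMul u (GMul v w)) (GMul (GMul u v) w)
| gwa_mul1l u : gwa_eq (GMul (GConst 1) u) u
| gwa_mul1r u : gwa_eq (GMul u (GConst 1)) u
| gwa_mulDl u v w : gwa_eq (GMul (GAdd u v) w) (GAdd (GMul u w) (GMul v w))
| gwa_mulDr u v w : gwa_eq (GMul u (GAdd v w)) (GAdd (GMul u v) (GMul u w))
| gwa_constD c d : gwa_eq (GConst (c + d)) (GAdd (GConst c) (GConst d))
| gwa_constM c d : gwa_eq (GConst (c * d)) (GMul (GConst c) (GConst d))
| gwa_xd d : gwa_eq (GMul GX (GConst d)) (GMul (GConst (sigma d)) GX)
| gwa_yd d : gwa_eq (GMul GY (GConst d)) (GMul (GConst (tau d)) GY)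
| gwa_yx : gwa_eq (GMul GY GX) (GConst a)
| gwa_xy : gwa_eq (GMul GX GY) (GConst (sigma a)).

Definition gwa_eqb (u v : gwa_expr D) : bool := `[< gwa_eq u v >].

Lemma gwa_eqb_refl : reflexive gwa_eqb.
Proof. by move=> u; apply/asboolP/gwa_refl. Qed.

Lemma gwa_eqb_sym : symmetric gwa_eqb.
Proof. by move=> u v; apply/asboolP/asboolP => /gwa_sym. Qed.

Lemma gwa_eqb_trans : transitive gwa_eqb.
Proof. by move=> v u w /asboolP uv /asboolP vw; apply/asboolP/(gwa_trans uv). Qed.

Canonical gwa_equiv := EquivRel gwa_eqb gwa_eqb_refl gwa_eqb_sym gwa_eqb_trans.

Definition gwa : Type := {eq_quot gwa_equiv}.
HB.instance Definition _ := Choice.on gwa.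
HB.instance Definition _ := Quotient.on gwa.

Lemma gwa_piP (u v : gwa_expr D) : \pi_gwa u = \pi_gwa v <-> gwa_eq u v.
Proof.
by split=> [/eqquotP/asboolP //|uv]; apply/eqquotP/asboolP.
Qed.

Lemma gwa_reprK (u : gwa_expr D) : gwa_eq (repr (\pi_gwa u)) u.
Proof. by apply/gwa_piP; rewrite reprK. Qed.

Definition gwa_zero : gwa := \pi_gwa (GConst 0).
Definition gwa_one : gwa := \pi_gwa (GConst 1).
Definition gwa_add (p q : gwa) : gwa := \pi_gwa (GAdd (repr p) (repr q)).
Definition gwa_opp (p : gwa) : gwa := \pi_gwa (GOpp (repr p)).
Definition gwa_mul (p q : gwa) : gwa := \pi_gwa (GMul (repr p) (repr q)).

Lemma gwa_piD u v : gwa_add (\pi_gwa u) (\pi_gwa v) = \pi_gwa (GAdd u v).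
Proof. by apply/gwa_piP; apply: gwa_congD; apply: gwa_reprK. Qed.

Lemma gwa_piN u : gwa_opp (\pi_gwa u) = \pi_gwa (GOpp u).
Proof. by apply/gwa_piP; apply: gwa_congN; apply: gwa_reprK. Qed.

Lemma gwa_piM u v : gwa_mul (\pi_gwa u) (\pi_gwa v) = \pi_gwa (GMul u v).
Proof. by apply/gwa_piP; apply: gwa_congM; apply: gwa_reprK. Qed.

Let gwa_ind_pi (P : gwa -> Prop) : (forall u, P (\pi_gwa u)) -> forall p, P p.
Proof. by move=> Ppi p; rewrite -[p]reprK. Qed.

Fact gwa_addA_subproof : associative gwa_add.
Proof.
elim/gwa_ind_pi=> u; elim/gwa_ind_pi=> v; elim/gwa_ind_pi=> w.
by rewrite !gwa_piD; apply/gwa_piP/gwa_addA.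
Qed.

Fact gwa_addC_subproof : commutative gwa_add.
Proof.
elim/gwa_ind_pi=> u; elim/gwa_ind_pi=> v.
by rewrite !gwa_piD; apply/gwa_piP/gwa_addC.
Qed.

Fact gwa_add0_subproof : left_id gwa_zero gwa_add.
Proof. by elim/gwa_ind_pi=> u; rewrite gwa_piD; apply/gwa_piP/gwa_add0. Qed.

Fact gwa_addN_subproof : left_inverse gwa_zero gwa_opp gwa_add.
Proof.
by elim/gwa_ind_pi=> u; rewrite gwa_piN gwa_piD; apply/gwa_piP/gwa_addN.
Qed.

Fact gwa_mulA_subproof : associative gwa_mul.
Proof.
elim/gwa_ind_pi=> u; elim/gwa_ind_pi=> v; elim/gwa_ind_pi=> w.
by rewrite !gwa_piM; apply/gwa_piP/gwa_mulA.
Qed.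

Fact gwa_mul1l_subproof : left_id gwa_one gwa_mul.
Proof. by elim/gwa_ind_pi=> u; rewrite gwa_piM; apply/gwa_piP/gwa_mul1l. Qed.

Fact gwa_mul1r_subproof : right_id gwa_one gwa_mul.
Proof. by elim/gwa_ind_pi=> u; rewrite gwa_piM; apply/gwa_piP/gwa_mul1r. Qed.

Fact gwa_mulDl_subproof : left_distributive gwa_mul gwa_add.
Proof.
elim/gwa_ind_pi=> u; elim/gwa_ind_pi=> v; elim/gwa_ind_pi=> w.
by rewrite !(gwa_piD, gwa_piM); apply/gwa_piP/gwa_mulDl.
Qed.

Fact gwa_mulDr_subproof : right_distributive gwa_mul gwa_add.
Proof.
elim/gwa_ind_pi=> u; elim/gwa_ind_pi=> v; elim/gwa_ind_pi=> w.
by rewrite !(gwa_piD, gwa_piM); apply/gwa_piP/gwa_mulDr.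
Qed.

HB.instance Definition _ := GRing.isZmodule.Build gwa
  gwa_addA_subproof gwa_addC_subproof gwa_add0_subproof gwa_addN_subproof.
HB.instance Definition _ := GRing.Zmodule_isPzRing.Build gwa
  gwa_mulA_subproof gwa_mul1l_subproof gwa_mul1r_subproof
  gwa_mulDl_subproof gwa_mulDr_subproof.

Definition gwa_const (d : D) : gwa := \pi_gwa (GConst d).
Definition gwa_x : gwa := \pi_gwa GX.
Definition gwa_y : gwa := \pi_gwa GY.

Lemma gwa_pi_add u v : \pi_gwa (GAdd u v) = \pi_gwa u + \pi_gwa v.
Proof. exact/esym/gwa_piD. Qed.

Lemma gwa_pi_opp u : \pi_gwa (GOpp u) = - \pi_gwa u.
Proof. exact/esym/gwa_piN. Qed.

Lemma gwa_pi_mul u v : \pi_gwa (GMul u v) = \pi_gwa u * \pi_gwa v.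
Proof. exact/esym/gwa_piM. Qed.

Lemma gwa_constDE c d : gwa_const (c + d) = gwa_const c + gwa_const d.
Proof. by rewrite -gwa_pi_add; apply/gwa_piP/gwa_constD. Qed.

Fact gwa_const_zmod : zmod_morphism gwa_const.
Proof.
by move=> c d; apply/eqP; rewrite eq_sym subr_eq -gwa_constDE subrK.
Qed.

Fact gwa_const_monoid : monoid_morphism gwa_const.
Proof.
by split=> // c d; rewrite -gwa_pi_mul; apply/gwa_piP/gwa_constM.
Qed.

HB.instance Definition _ :=
  GRing.isZmodMorphism.Build D gwa gwa_const gwa_const_zmod.
HB.instance Definition _ :=
  GRing.isMonoidMorphism.Build D gwa gwa_const gwa_const_monoid.

Lemma gwa_xdE d : gwa_x * gwa_const d = gwa_const (sigma d) * gwa_x.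
Proof. by rewrite -!gwa_pi_mul; apply/gwa_piP/gwa_xd. Qed.

Lemma gwa_ydE d : gwa_y * gwa_const d = gwa_const (tau d) * gwa_y.
Proof. by rewrite -!gwa_pi_mul; apply/gwa_piP/gwa_yd. Qed.

Lemma gwa_yxE : gwa_y * gwa_x = gwa_const a.
Proof. by rewrite -gwa_pi_mul; apply/gwa_piP/gwa_yx. Qed.

Lemma gwa_xyE : gwa_x * gwa_y = gwa_const (sigma a).
Proof. by rewrite -gwa_pi_mul; apply/gwa_piP/gwa_xy. Qed.

Section UniversalProperty.
Variables (B : pzRingType) (f : {rmorphism D -> B}) (x y : B).
Hypotheses (fxd : forall d, x * f d = f (sigma d) * x)
           (fyd : forall d, y * f d = f (tau d) * y)
           (fyx : y * x = f a) (fxy : x * y = f (sigma a)).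

Fixpoint gwa_eval (u : gwa_expr D) : B :=
  match u with
  | GConst d => f d
  | GX => x
  | GY => y
  | GAdd u v => gwa_eval u + gwa_eval v
  | GOpp u => - gwa_eval u
  | GMul u v => gwa_eval u * gwa_eval v
  end.

Lemma gwa_eval_eq u v : gwa_eq u v -> gwa_eval u = gwa_eval v.
Proof.
elim=> {u v} /=.
- by [].
- by move=> u v _ ->.
- by move=> u v w _ -> _ ->.
- by move=> u u' v v' _ -> _ ->.
- by move=> u u' _ ->.
- by move=> u u' v v' _ -> _ ->.
- by move=> u v w; rewrite addrA.
- by move=> u v; rewrite addrC.
- by move=> u; rewrite rmorph0 add0r.
- by move=> u; rewrite rmorph0 addNr.
- by move=> u v w; rewrite mulrA.
- by move=> u; rewrite rmorph1 mul1r.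
- by move=> u; rewrite rmorph1 mulr1.
- by move=> u v w; rewrite mulrDl.
- by move=> u v w; rewrite mulrDr.
- by move=> c d; rewrite rmorphD.
- by move=> c d; rewrite rmorphM.
- exact: fxd.
- exact: fyd.
- exact: fyx.
- exact: fxy.
Qed.

Lemma gwa_universal : exists g : {rmorphism gwa -> B},
  [/\ forall d, g (gwa_const d) = f d, g gwa_x = x, g gwa_y = y &
      forall h : {rmorphism gwa -> B},
        (forall d, h (gwa_const d) = f d) -> h gwa_x = x -> h gwa_y = y ->
        h =1 g].
Proof.
pose g (p : gwa) : B := gwa_eval (repr p).
have gpi u : g (\pi_gwa u) = gwa_eval u by exact/gwa_eval_eq/gwa_reprK.
have gB : zmod_morphism g.
  elim/gwa_ind_pi=> u; elim/gwa_ind_pi=> v.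
  by rewrite -gwa_pi_opp -gwa_pi_add !gpi.
have gM : monoid_morphism g.
  split; first exact: etrans (gpi (GConst 1)) (rmorph1 f).
  elim/gwa_ind_pi=> u; elim/gwa_ind_pi=> v.
  by rewrite -gwa_pi_mul !gpi.
pose gZ := GRing.isZmodMorphism.Build _ _ g gB.
pose gR := GRing.isMonoidMorphism.Build _ _ g gM.
pose G : {rmorphism gwa -> B} := HB.pack g gZ gR.
exists G; split=> [d|||h hd hx hy]; try exact: gpi.
elim/gwa_ind_pi=> u; rewrite [RHS]gpi.
elim: u => [d|||u IHu v IHv|u IHu|u IHu v IHv] /=.
- exact: hd.
- exact: hx.
- exact: hy.
- by rewrite gwa_pi_add rmorphD IHu IHv.
- by rewrite gwa_pi_opp rmorphN IHu.
- by rewrite gwa_pi_mul rmorphM IHu IHv.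
Qed.
End UniversalProperty.

End Presentation.

(* Main.v *)
Require Import Defs.
From HB Require Import structures.
From mathcomp Require Import all_boot all_algebra.
Import GRing.Theory.
Local Open Scope ring_scope.

(** An involution of [A] is the same thing as a ring morphism from [A] to its
    opposite ring [A^c] whose square is the identity.  The universal property
    of the presentation of [A] produces such a morphism as soon as [y], [x] and
    the elements [star d], read in [A^c], satisfy the defining relations of
    [A].  Multiplication being reversed, the relation [x d = sigma d x]
    becomes [star d y = y (star (sigma d))]; the right-hand side is
    [tau (star (sigma d)) y], which the hypothesis on [tau], [star] and [sigma]
    identifies with the left-hand side.  The relation for [y] follows in the
    same way from the hypothesis on [sigma], [star] and [tau], while [y x = a]
    and [x y = sigma a] are carried to themselves because [a] and [sigma a] are
    fixed by [star].  The square of the resulting map is a ring endomorphism of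
    [A] that fixes [D], [x] and [y], hence the identity by the uniqueness part
    of the universal property ([gwa_rmorph_id]). *)

(** An additive map that reverses products is a ring morphism to the opposite
    ring, up to the image of 1: that image is neutral for the products with
    the elements [f r], which are all of [R]. *)
Lemma involution_rmorph (R : pzRingType) (f : R -> R) :
  involution f -> zmod_morphism f /\ monoid_morphism (f : R -> R^c).
Proof.
move=> [[_ fD fM] fK].
split=> [r s|]; first by apply: (canRL (addrK _)); rewrite -fD subrK.
by split=> [|r s]; rewrite ?fM // -[LHS]mulr1 -[X in _ * X]fK -fM mulr1 fK.
Qed.

Lemma gwa_rmorph_id (D : pzRingType) (sigma tau : {rmorphism D -> D}) (a : D)
    (h : {rmorphism gwa sigma tau a -> gwa sigma tau a}) :
    (forall d, h (gwa_const sigma tau a d) = gwa_const sigma tau a d) ->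
    h (gwa_x sigma tau a) = gwa_x sigma tau a ->
    h (gwa_y sigma tau a) = gwa_y sigma tau a ->
  h =1 id.
Proof.
move=> hd hx hy p.
have [g [_ _ _ g_unique]] :=
  @gwa_universal _ sigma tau a _ (gwa_const sigma tau a) _ _
    (gwa_xdE sigma tau a) (gwa_ydE sigma tau a)
    (gwa_yxE sigma tau a) (gwa_xyE sigma tau a).
by rewrite (g_unique h) // -(g_unique idfun).
Qed.

Theorem lemma3p3 (D : pzRingType) (sigma tau : {rmorphism D -> D}) (a : D)
    (hgwa : gwa_datum sigma tau a)
    (star : D -> D) (hstar : involution star)
    (hst : forall d : D, sigma (star (tau d)) = star d)
    (hts : forall d : D, tau (star (sigma d)) = star d)
    (ha : star a = a) (hsa : star (sigma a) = sigma a) :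
  exists starA : gwa sigma tau a -> gwa sigma tau a,
    [/\ involution starA,
        forall d : D,
          starA (gwa_const sigma tau a d) = gwa_const sigma tau a (star d),
        starA (gwa_x sigma tau a) = gwa_y sigma tau a &
        starA (gwa_y sigma tau a) = gwa_x sigma tau a].
Proof.
have [starB [star1 starM]] := involution_rmorph _ _ hstar.
have starK := hstar.2.
set A := gwa sigma tau a; set x := gwa_x _ _ _; set y := gwa_y _ _ _.
pose c : {rmorphism D -> A} := gwa_const sigma tau a.
pose f (d : D) : A^c := c (star d).
have fB : zmod_morphism f by move=> d e; rewrite /f starB rmorphB.
have fM : monoid_morphism f.
  split=> [|d e]; first exact: etrans (congr1 c star1) (rmorph1 c).
  exact: etrans (congr1 c (starM d e)) (rmorphM c _ _).
pose F : {rmorphism D -> A^c} :=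
  HB.pack f (GRing.isZmodMorphism.Build _ _ f fB)
            (GRing.isMonoidMorphism.Build _ _ f fM).
have Fxd d : (y : A^c) * F d = F (sigma d) * (y : A^c).
  by rewrite /= /f; apply: esym; rewrite -(hts d); exact: gwa_ydE.
have Fyd d : (x : A^c) * F d = F (tau d) * (x : A^c).
  by rewrite /= /f; apply: esym; rewrite -(hst d); exact: gwa_xdE.
have Fyx : (x : A^c) * (y : A^c) = F a.
  by rewrite /= /f ha; exact: gwa_yxE.
have Fxy : (y : A^c) * (x : A^c) = F (sigma a).
  by rewrite /= /f hsa; exact: gwa_xyE.
have [g [gd gx gy _]] := gwa_universal Fxd Fyd Fyx Fxy.
pose gg (p : A) : A := g (g p).
have ggB : zmod_morphism gg by move=> p q; rewrite /gg !rmorphB.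
have ggM : monoid_morphism gg.
  split=> [|p q]; rewrite /gg; first by rewrite !rmorph1.
  by rewrite rmorphM; exact: (rmorphM g).
pose G : {rmorphism A -> A} :=
  HB.pack gg (GRing.isZmodMorphism.Build _ _ gg ggB)
             (GRing.isMonoidMorphism.Build _ _ gg ggM).
have gK : involutive (g : A -> A).
  apply: (gwa_rmorph_id _ _ _ _ G) => [d||]; rewrite /= /gg.
  - by rewrite gd; exact: etrans (gd (star d)) (congr1 c (starK d)).
  - by rewrite gx.
  - by rewrite gy.
exists g; split=> //; split=> //.
by split; [exists g | exact: (rmorphD g) | exact: (rmorphM g)].
Qed.
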